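(* Let $A_n$ be a self-adjoint operator in a Hilbert space $\mathcal H_n$ for each $n\in\overline{\mathbb N}$, let $z_0\in\bigcap_{n\in\overline{\mathbb N}}\rho(A_n)$, and suppose that $(A_n)_{n\in\mathbb N}$ Weidmann-converges to $A_\infty$ at $z_0$ with convergence speed $(\delta_n)_n$. Then $(A_n)_{n\in\mathbb N}$ QUE-converges to $A_\infty$ at $z_0$ with the same convergence speed $(\delta_n)_n$.
   Context: All Hilbert spaces are complex and separable; $\mathbb N=\{1,2,\dots\}$, $\overline{\mathbb N}=\mathbb N\cup\{\infty\}$; norms of operators are operator norms; $\rho(A)$ is the resolvent set. For $z_0\in\bigcap_{n\in\overline{\mathbb N}}\rho(A_n)$ write $R_n:=(A_n-z_0)^{-1}$, $n\in\overline{\mathbb N}$. Let $(\delta_n)_{n\in\mathbb N}$ be a sequence in $[0,\infty)$ with $\delta_n\to0$. $(A_n)_{n\in\mathbb N}$ Weidmann-converges to $A_\infty$ at $z_0$ with convergence speed $(\delta_n)_n$ if there exist a Hilbert space $\mathcal H$ (parent space) and isometries $\iota_n:\mathcal H_n\to\mathcal H$ ($n\in\overline{\mathbb N}$) such that $\|\iota_nR_n\iota_n^*-\iota_\infty R_\infty\iota_\infty^*\|\le\delta_n$ for all $n\in\mathbb N$. $(A_n)_{n\in\mathbb N}$ QUE-converges to $A_\infty$ at $z_0$ with convergence speed $(\delta_n)_n$ if there exist bounded operators $J_n:\mathcal H_n\to\mathcal H_\infty$ ($n\in\mathbb N$), called identification operators, such that for all $n\in\mathbb N$: (i) $\|J_n\|\le1+\delta_n$;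 (ii) $\|(\mathrm{id}_{\mathcal H_n}-J_n^*J_n)R_n\|\le\delta_n$ and $\|(\mathrm{id}_{\mathcal H_\infty}-J_nJ_n^* )R_\infty\|\le\delta_n$; (iii) $\|R_\infty J_n-J_nR_n\|\le\delta_n$; and, if $z_0\in\mathbb C\setminus\mathbb R$, (ii) and (iii) also hold with $R_n,R_\infty$ replaced by $R_n^*,R_\infty^*$. *)

(* Defs.v *)
From HB Require Import structures.
From mathcomp Require Import all_boot all_order all_algebra.
From mathcomp Require Import all_classical all_reals all_analysis.
From mathcomp Require Import complex.

Set Implicit Arguments.
Unset Strict Implicit.
Unset Printing Implicit Defensive.

Import Order.TTheory GRing.Theory Num.Theory Num.Def.
Import numFieldNormedType.Exports.

Local Open Scope classical_set_scope.
Local Open Scope complex_scope.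
Local Open Scope ring_scope.

(* The inner product is linear in its first argument. *)
Record hilbertSpace (R : realType) := HilbertSpace {
  hilbert_sort :> completeNormedModType R[i];
  inner : {dot hilbert_sort for conjC};
  inner_norm : forall x : hilbert_sort, inner x x = `|x| ^+ 2;
  hilbert_separable :
    exists2 D : set hilbert_sort, countable D & dense D }.

(* The norm of a space over R[i] takes its values in (the real part of) R[i].
   The operator norm lives in \bar R, so that it is +oo for an unbounded
   linear map. *)
Definition opnorm (R : realType) (H K : hilbertSpace R) (T : H -> K) : \bar R :=
  ereal_sup [set (complex.Re `|T x|)%:E | x in [set x : H | `|x| <= 1]].

Definition bounded_operator (R : realType) (H K : hilbertSpace R)
    (T : {linear H -> K}) : Prop :=
  (opnorm T < +oo)%E.

(* When T is a bounded linear map, adjoint T y is the unique vector x (it exists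
   by the Riesz representation theorem) such that <T u, y> = <u, x> for all
   u. *)
Definition adjoint (R : realType) (H K : hilbertSpace R) (T : H -> K) :
    K -> H :=
  fun y => get [set x : H | forall u : H, inner K (T u) y = inner H u x].

Definition isometric (R : realType) (H K : hilbertSpace R)
    (T : {linear H -> K}) : Prop :=
  forall x : H, `|T x| = `|x|.

(* A linear operator in H with domain dom; the values of op_fun outside of dom
   are irrelevant. *)
Record operator_in (R : realType) (H : hilbertSpace R) := OperatorIn {
  dom : set H;
  op_fun :> H -> H;
  dom_0 : dom 0;
  dom_linear : forall (a : R[i]) (x y : H), dom x -> dom y -> dom (a *: x + y);
  op_linear : forall (a : R[i]) (x y : H), dom x -> dom y ->
    op_fun (a *: x + y) = a *: op_fun x + op_fun y }.

Definition op_graph (R : realType) (H : hilbertSpace R) (A : operator_in H) :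
    set (H * H) :=
  [set p | dom A p.1 /\ A p.1 = p.2].

(* When dom A is dense, this is the graph of the Hilbert space adjoint of A. *)
Definition adjoint_graph (R : realType) (H : hilbertSpace R)
    (A : operator_in H) : set (H * H) :=
  [set p | forall x : H, dom A x -> inner H (A x) p.1 = inner H x p.2].

Definition selfadjoint (R : realType) (H : hilbertSpace R)
    (A : operator_in H) : Prop :=
  dense (dom A) /\ op_graph A = adjoint_graph A.

(* (A - z)^-1, the inverse of A - z : dom A -> H; it is meaningful only when
   that map is bijective. *)
Definition resolvent (R : realType) (H : hilbertSpace R) (A : operator_in H)
    (z : R[i]) : H -> H :=
  pinv (dom A) (fun x => A x - z *: x).

Definition resolvent_set (R : realType) (H : hilbertSpace R)
    (A : operator_in H) : set R[i] :=
  [set z | set_bij (dom A) setT (fun x => A x - z *: x) /\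
           (opnorm (resolvent A z) < +oo)%E].

(* H n, A n are indexed by n = 0, 1, 2, ... instead of n = 1, 2, ...; the index
   infinity is treated separately, by Hinf and Ainf. *)
Definition Weidmann_converges (R : realType) (H : nat -> hilbertSpace R)
    (Hinf : hilbertSpace R) (A : forall n, operator_in (H n))
    (Ainf : operator_in Hinf) (z0 : R[i]) (delta : nat -> R) : Prop :=
  exists (P : hilbertSpace R) (iota : forall n, {linear H n -> P})
         (iotainf : {linear Hinf -> P}),
    [/\ forall n, isometric (iota n),
        isometric iotainf &
        forall n, (opnorm ((iota n \o resolvent (A n) z0 \o adjoint (iota n)) \-
            (iotainf \o resolvent Ainf z0 \o adjoint iotainf))%R
          <= (delta n)%:E)%E].

(* J is unitary up to an error d, relative to RH and RK, and intertwines RH and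
   RK up to d. Below, (RH, RK) is (R_n, R_oo) and, for non-real z0, also
   (R_n^*, R_oo^* ). *)
Definition quasi_unitary_close (R : realType) (H K : hilbertSpace R)
    (J : H -> K) (RH : H -> H) (RK : K -> K) (d : R) : Prop :=
  [/\ (opnorm ((idfun \- (adjoint J \o J)) \o RH)%R <= d%:E)%E,
      (opnorm ((idfun \- (J \o adjoint J)) \o RK)%R <= d%:E)%E &
      (opnorm ((RK \o J) \- (J \o RH))%R <= d%:E)%E].

Definition QUE_converges (R : realType) (H : nat -> hilbertSpace R)
    (Hinf : hilbertSpace R) (A : forall n, operator_in (H n))
    (Ainf : operator_in Hinf) (z0 : R[i]) (delta : nat -> R) : Prop :=
  exists J : forall n, {linear H n -> Hinf},
    (forall n, bounded_operator (J n)) /\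
    forall n,
    [/\ (opnorm (J n) <= (1 + delta n)%:E)%E,
        quasi_unitary_close (J n) (resolvent (A n) z0) (resolvent Ainf z0)
          (delta n) &
        z0 \isn't Num.real ->
        quasi_unitary_close (J n) (adjoint (resolvent (A n) z0))
          (adjoint (resolvent Ainf z0)) (delta n)].

(* Main.v *)
(* With isometries i_n : H_n -> P and i : H_oo -> P, write S' for the adjoint of
   S, and put J_n := i' i_n and D_n := i_n R_n i_n' - i R_oo i'.  The QUE errors
   are
     (1 - J_n' J_n) R_n = i_n' (1 - i i') D_n i_n,
     (1 - J_n J_n') R_oo = - i' (1 - i_n i_n') D_n i,
     R_oo J_n - J_n R_n = - i' D_n i_n,
   since 1 - i i' kills the range of i, and likewise for i_n.  As i', i_n',
   1 - i i' and 1 - i_n i_n' are contractions, all three are bounded by |D_n|.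
   Replacing the resolvents by their adjoints replaces D_n by D_n', which has
   the same norm. *)

From HB Require Import structures.
Require Import Defs.
From mathcomp Require Import all_boot all_order all_algebra.
From mathcomp Require Import all_classical all_reals all_analysis complex.
From mathcomp Require Import ring lra.
Import Order.TTheory GRing.Theory Num.Theory.
Import numFieldNormedType.Exports.
Local Open Scope classical_set_scope.
Local Open Scope complex_scope.
Local Open Scope ring_scope.

(** Norm inequalities are handled in the ordered field [R]; nothing is lost, since the [R[i]]-valued
    norm is real. *)
Definition nrm {R : realType} {H : hilbertSpace R} (x : H) : R := complex.Re `|x|.

(** * Real-valued norms and inner product identities *)

Section Norm.
Context {R : realType} {H : hilbertSpace R}.
Implicit Types (x y u v : H) (a b : R[i]).

Lemma normE x : `|x| = (nrm x)%:C.
Proof. by rewrite /nrm RRe_real// ger0_real. Qed.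

Lemma nrm_ge0 x : 0 <= nrm x.
Proof. by rewrite -lecR -normE; exact: normr_ge0. Qed.

Lemma nrm0 : nrm (0 : H) = 0.
Proof. by rewrite /nrm normr0. Qed.

Lemma nrm0_eq0 {x} : nrm x = 0 -> x = 0.
Proof. by move=> x0; apply/normr0_eq0; rewrite normE x0. Qed.

Lemma nrmN x : nrm (- x) = nrm x.
Proof. by rewrite /nrm normrN. Qed.

Lemma nrmB_sym x y : nrm (x - y) = nrm (y - x).
Proof. by rewrite -nrmN opprB. Qed.

Lemma nrmD x y : nrm (x + y) <= nrm x + nrm y.
Proof. by rewrite -lecR rmorphD/= -!normE ler_normD. Qed.

Lemma nrmZ a x : nrm (a *: x) = complex.Re `|a| * nrm x.
Proof.
rewrite /nrm normrZ (normE x).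
by rewrite -[X in X * _](RRe_real (ger0_real (normr_ge0 a))) -rmorphM.
Qed.

Lemma nrmZr (t : R) x : nrm (t%:C *: x) = `|t| * nrm x.
Proof. by rewrite nrmZ normc_def/= expr0n/= addr0 sqrtr_sqr. Qed.

Lemma innerDl u v x : inner H (u + v) x = inner H u x + inner H v x.
Proof. exact: linearDl. Qed.

Lemma innerDr x u v : inner H x (u + v) = inner H x u + inner H x v.
Proof. exact: linearDr. Qed.

Lemma innerBl u v x : inner H (u - v) x = inner H u x - inner H v x.
Proof. exact: linearBl. Qed.

Lemma innerBr x u v : inner H x (u - v) = inner H x u - inner H x v.
Proof. exact: linearBr. Qed.

Lemma innerZl a u x : inner H (a *: u) x = a * inner H u x.
Proof. exact: linearZl_LR. Qed.

Lemma innerC u v : inner H u v = (inner H v u)^*.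
Proof. by rewrite hermC expr0 mul1r. Qed.

Lemma innerZr a u v : inner H u (a *: v) = a^* * inner H u v.
Proof. by rewrite innerC innerZl rmorphM/= -innerC. Qed.

Lemma innerxx x : inner H x x = (nrm x ^+ 2)%:C.
Proof. by rewrite inner_norm normE rmorphXn. Qed.

Lemma Re_innerC u v : complex.Re (inner H u v) = complex.Re (inner H v u).
Proof. by rewrite innerC; case: (inner H v u). Qed.

Lemma Re_real_mul (t : R) a : complex.Re (t%:C * a) = t * complex.Re a.
Proof. by case: a => a b /=; rewrite mul0r subr0. Qed.

Lemma nrm_sqE x : nrm x ^+ 2 = complex.Re (inner H x x).
Proof. by rewrite innerxx. Qed.

Lemma ReD a b : complex.Re (a + b) = complex.Re a + complex.Re b.
Proof. by case: a b => [? ?] [? ?]. Qed.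

Lemma ReB a b : complex.Re (a - b) = complex.Re a - complex.Re b.
Proof. by case: a b => [? ?] [? ?]. Qed.

Lemma nrmDsq u v :
  nrm (u + v) ^+ 2 = nrm u ^+ 2 + nrm v ^+ 2 + 2 * complex.Re (inner H u v).
Proof.
rewrite !nrm_sqE innerDl !innerDr !ReD (Re_innerC v u); ring.
Qed.

Lemma nrmBsq u v :
  nrm (u - v) ^+ 2 = nrm u ^+ 2 + nrm v ^+ 2 - 2 * complex.Re (inner H u v).
Proof.
rewrite !nrm_sqE innerBl !innerBr !ReB (Re_innerC v u); ring.
Qed.

(* The triangle inequality for u + v, squared. *)
Lemma Re_inner_le u v : complex.Re (inner H u v) <= nrm u * nrm v.
Proof.
have := nrmDsq u v; have := nrmD u v.
have := nrm_ge0 u; have := nrm_ge0 v; have := nrm_ge0 (u + v).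
nra.
Qed.

Lemma normr_Re_inner_le u v : `|complex.Re (inner H u v)| <= nrm u * nrm v.
Proof.
rewrite ler_norml Re_inner_le andbT lerNl.
have := Re_inner_le (- u) v.
by rewrite nrmN -scaleN1r innerZl mulN1r; case: (inner H u v).
Qed.

Lemma inner_inj u v : (forall w, inner H w u = inner H w v) -> u = v.
Proof.
move=> uv; apply/eqP; rewrite -subr_eq0; apply/eqP/nrm0_eq0/eqP.
by rewrite -sqrf_eq0 nrm_sqE innerBr uv subrr.
Qed.

(* The imaginary part of an inner product is recovered from the real part of
   the product with ['i *: w]. *)
Lemma eq_ReP (f g : H -> R[i]) :
  (forall a w, f (a *: w) = a * f w) -> (forall a w, g (a *: w) = a * g w) ->
  (forall w, complex.Re (f w) = complex.Re (g w)) -> f =1 g.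
Proof.
move=> fZ gZ fg w; have := fg ('i *: w); have := fg w.
rewrite fZ gZ; case: (f w) (g w) => [a b] [c d] /= -> .
by rewrite !mul0r !mul1r !sub0r => /oppr_inj ->.
Qed.

End Norm.

(** * Operator bounds and the operator norm *)

Definition bounded_by {R : realType} {H K : hilbertSpace R} (T : H -> K) (d : R) :=
  forall x : H, nrm (T x) <= d * nrm x.

(** A symmetric relation that describes adjoints without the choice of a vector made in
    [adjoint]. *)
Definition adjoint_pair {R : realType} {H K : hilbertSpace R}
    (T : H -> K) (S : K -> H) :=
  forall u y, inner K (T u) y = inner H u (S y).

Section OperatorNorm.
Context {R : realType} {H K : hilbertSpace R}.

Lemma nrm_le1 (x : H) : (`|x| <= 1) = (nrm x <= 1).
Proof. by rewrite normE -(lecR (nrm x)). Qed.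

Lemma bounded_by_opnorm {T : H -> K} {d} :
  0 <= d -> bounded_by T d -> (opnorm T <= d%:E)%E.
Proof.
move=> d0 Td; apply: ge_ereal_sup => _ [x /= x1 <-].
rewrite lee_fin; apply: (le_trans (Td x)).
by rewrite ler_piMr// -nrm_le1.
Qed.

Lemma opnorm_bounded_by {T : {linear H -> K}} {d} :
  (opnorm T <= d%:E)%E -> bounded_by T d.
Proof.
move=> Td x; have [x0|x0] := eqVneq (nrm x) 0.
  by rewrite (nrm0_eq0 x0) linear0 !nrm0 mulr0.
have px : 0 < nrm x by rewrite lt_neqAle eq_sym x0 nrm_ge0.
have : nrm (T ((nrm x)^-1%:C *: x)) <= d.
  rewrite -lee_fin; apply: le_trans Td; apply: ereal_sup_ubound.
  exists ((nrm x)^-1%:C *: x) => //=.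
  by rewrite nrm_le1 nrmZr gtr0_norm ?invr_gt0// mulVf.
by rewrite linearZ nrmZr gtr0_norm ?invr_gt0// ler_pdivrMl// mulrC.
Qed.

Lemma opnorm_lty_bounded_by {T : {linear H -> K}} :
  (opnorm T < +oo)%E -> exists d, bounded_by T d.
Proof.
move=> Too; suff [d Td] : exists d, (opnorm T <= d%:E)%E.
  by exists d; exact: opnorm_bounded_by.
by case: (opnorm T) Too => [r| |]// _; [exists r | exists 0; rewrite leNye].
Qed.

(** Serves to bundle maps obtained by pointwise choice, such as adjoints and resolvents, once they
    are shown linear. *)
Lemma linear_pack (f : H -> K) :
  linear f -> exists g : {linear H -> K}, g = f :> (H -> K).
Proof.
move=> lf; pose F := GRing.isLinear.Build _ _ _ _ f lf.
by exists (HB.pack_for {linear H -> K} f F).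
Qed.

End OperatorNorm.

(** * Riesz representation *)

Section Riesz.
Context {R : realType} {H : hilbertSpace R}.

(** For [x < 0], the value [e = - x / (|c| + 1) / 2] keeps [c * e] at most [- x / 2], so [x + c * e]
    would be negative. *)
Lemma ge0_of_eps {x c : R} : (forall e, 0 < e -> 0 <= x + c * e) -> 0 <= x.
Proof.
move=> xc; rewrite leNgt; apply/negP => x0.
have c1 : 0 < `|c| + 1 by rewrite ltr_wpDl.
have := xc (- x / (`|c| + 1) / 2); rewrite !divr_gt0 ?oppr_gt0// => /(_ isT).
apply/negP; rewrite -ltNge.
have : c * (- x / (`|c| + 1) / 2) <= (`|c| + 1) * (- x / (`|c| + 1) / 2).
  apply: ler_wpM2r; first by rewrite !divr_ge0// ?oppr_ge0 ltW.
  by have := ler_norm c; lra.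
have -> : (`|c| + 1) * (- x / (`|c| + 1) / 2) = - x / 2.
  by field; rewrite gt_eqF.
lra.
Qed.

(* [x] is the limit of a minimising sequence of [|u|^2 - 2 Re f(u)], which is
   Cauchy by the parallelogram law. *)
Lemma Riesz_representation {f : {scalar H}} {M : R} :
  (forall u, complex.Re (f u) <= M * nrm u) ->
  exists x, forall u, f u = inner H u x.
Proof.
move=> fM.
have fD v w : complex.Re (f (v + w)) = complex.Re (f v) + complex.Re (f w).
  by rewrite linearD ReD.
have fZ (t : R) v : complex.Re (f (t%:C *: v)) = t * complex.Re (f v).
  by rewrite linearZ Re_real_mul.
pose phi u := nrm u ^+ 2 - 2 * complex.Re (f u).
have phi_ge u : - M ^+ 2 <= phi u.
  by have := fM u; have := sqr_ge0 (nrm u - M); rewrite /phi; nra.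
have phi_inf : has_inf (range phi).
  split; first by exists (phi 0), 0.
  by exists (- M ^+ 2) => _ [u _ <-].
pose m := inf (range phi).
have m_le u : m <= phi u by apply: ge_inf; [case: phi_inf | exists u].
pose eps n : R := n.+1%:R^-1.
have eps_gt0 n : 0 < eps n by rewrite invr_gt0.
have /choice[u u_min] n : exists u, phi u < m + eps n.
  by have [_ [u _ <-] ?] := inf_adherent (eps_gt0 n) phi_inf; exists u.
(* With [c] the midpoint, the parallelogram law gives [|v - w|^2 = 2 phi v + 2 phi w - 4 phi c], as
   the linear terms cancel; then [phi c >= m]. *)
have dist v w : nrm (v - w) ^+ 2 <= 2 * (phi v - m) + 2 * (phi w - m).
  pose c := (2^-1 : R)%:C *: (v + w).
  have : nrm c ^+ 2 = 4^-1 * nrm (v + w) ^+ 2.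
    by rewrite nrmZr exprMn ger0_norm ?invr_ge0//; field.
  have : complex.Re (f c) = 2^-1 * (complex.Re (f v) + complex.Re (f w)).
    by rewrite fZ fD.
  have := m_le c; rewrite nrmDsq nrmBsq /phi => ? ? ?; lra.
have u_cauchy : cauchy (u @ \oo).
  apply: cauchy_exP => e e0.
  have [r re r0] : exists2 r, e = r%:C & 0 < r.
    exists (complex.Re e); first by rewrite RRe_real ?gtr0_real.
    by move: e0; rewrite ltcE => /andP[].
  (* If [phi] exceeds [m] by less than [r ^+ 2 / 4] at two points, [dist] puts them at squared
     distance below [r ^+ 2]. *)
  have r2 : 0 < r ^+ 2 / 4 by rewrite divr_gt0// exprn_gt0.
  have [N _ Nr] := near_infty_natSinv_lt (PosNum r2).
  exists (u N); exists N => //= n /Nr/= nr.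
  rewrite -ball_normE/= re normE ltcR.
  rewrite -(ltr_pXn2r (n := 2)) ?nnegrE ?nrm_ge0 ?ltW//.
  have NN : eps N < r ^+ 2 / 4 := Nr N (leqnn N).
  have {}nr : eps n < r ^+ 2 / 4 := nr.
  by have := u_min N; have := u_min n; have := dist (u N) (u n); lra.
have /cvg_ex[x ux] : cvg (u @ \oo) by exact: cauchy_cvg.
have close e : 0 < e -> exists2 n, eps n <= e & nrm (u n - x) <= e.
  move=> e0; near \oo => n; exists n.
    by near: n; apply: filterS (near_infty_natSinv_lt (PosNum e0)) => n /ltW.
  rewrite nrmB_sym -lecR -normE; near: n.
  by have /cvgrPdist_le := ux; apply; rewrite ltcR.
have Re_eq h : complex.Re (f h) = complex.Re (inner H h x).
  (* First variation at [x] in direction [t h], made at a nearby [u n]. The error is at most [e] for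
     near-minimality plus [2 |t| |h| e] for replacing [u n] by [x]. *)
  have quad t : 0 <= t ^+ 2 * nrm h ^+ 2
     + t * (2 * (complex.Re (inner H h x) - complex.Re (f h))).
    apply: (@ge0_of_eps _ (1 + 2 * `|t| * nrm h)) => e /close[n ne nx].
    have := m_le (u n + t%:C *: h); have := u_min n.
    rewrite /phi nrmDsq nrmZr exprMn real_normK ?num_real//.
    rewrite fD fZ Re_innerC innerZl Re_real_mul.
    have /ler_normlP[] : `|complex.Re (inner H (t%:C *: h) (u n - x))| <= `|t| * nrm h * e.
      apply: le_trans (normr_Re_inner_le _ _) _.
      by rewrite nrmZr ler_wpM2l// mulr_ge0// nrm_ge0.
    rewrite innerZl Re_real_mul innerBr ReB; lra.
  set a := nrm h ^+ 2 in quad.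
  set b := 2 * (complex.Re (inner H h x) - complex.Re (f h)) in quad.
  have a1 : a + 1 != 0 by rewrite gt_eqF// ltr_wpDl// sqr_ge0.
  (* This [t] turns the quadratic into minus a square, which forces [b = 0]; the denominator [a + 1]
     stays nonzero even for [h = 0]. *)
  have := quad (- (b / (a + 1))).
  have -> : (- (b / (a + 1))) ^+ 2 * a + - (b / (a + 1)) * b = - (b / (a + 1)) ^+ 2.
    by field.
  rewrite oppr_ge0 => b2; have /eqP : (b / (a + 1)) ^+ 2 = 0.
    by apply/eqP; rewrite eq_le b2 sqr_ge0.
  by rewrite sqrf_eq0 mulf_eq0 invr_eq0 (negbTE a1) orbF /b => /eqP; lra.
exists x; apply: eq_ReP => // [a w|a w]; [exact: linearZ | exact: innerZl].
Unshelve. all: by end_near. Qed.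

End Riesz.

(** * Existence, uniqueness and bounds of adjoints *)

Section Adjoint.
Context {R : realType} {H K : hilbertSpace R}.

Lemma adjoint_pair_sym {T : H -> K} {S : K -> H} :
  adjoint_pair T S -> adjoint_pair S T.
Proof. by move=> TS u y; rewrite innerC -TS -innerC. Qed.

(** The vector selected by [get] exists, with witness [S y], and is unique because the inner product
    is nondegenerate. *)
Lemma adjointE {T : H -> K} {S : K -> H} : adjoint_pair T S -> adjoint T = S.
Proof.
move=> TS; apply/funext => y; apply: inner_inj => u; rewrite -TS.
rewrite /adjoint; set X := [set x | _].
have /(_ u)/= -> // : X (get X).
by apply: getPex; exists (S y) => v /=; rewrite TS.
Qed.

(** Divide [|S y|^2 = <T (S y), y> <= d |S y| |y|] by [|S y|]. *)
Lemma bounded_by_adjoint {T : H -> K} {S : K -> H} {d} :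
  0 <= d -> adjoint_pair T S -> bounded_by T d -> bounded_by S d.
Proof.
move=> d0 TS Td y; have [Sy0|Sy0] := eqVneq (nrm (S y)) 0.
  by rewrite Sy0 mulr_ge0 ?nrm_ge0.
have Sy : 0 < nrm (S y) by rewrite lt_neqAle eq_sym Sy0 nrm_ge0.
rewrite -(ler_pM2l Sy) -expr2 nrm_sqE -TS.
apply: le_trans (Re_inner_le _ _) _.
by rewrite mulrA [_ * d]mulrC ler_wpM2r ?nrm_ge0.
Qed.

(** Riesz representation applies to [u |-> <T u, y>], with bound [d * nrm y]; uniqueness of the
    representing vectors makes their choice linear in [y]. *)
Lemma adjoint_exists {T : {linear H -> K}} {d} :
  bounded_by T d -> exists S : {linear K -> H}, adjoint_pair T S.
Proof.
move=> Td.
have /choice[S TS] y : exists x, forall u, inner K (T u) y = inner H u x.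
  have lf : scalar (fun u => inner K (T u) y).
    by move=> a u v; rewrite linearP innerDl innerZl.
  pose F := GRing.isLinear.Build _ _ _ _ (fun u => inner K (T u) y) lf.
  pose f := HB.pack_for {scalar H} (fun u => inner K (T u) y) F.
  apply: (@Riesz_representation _ _ f (d * nrm y)) => u.
  apply: le_trans (Re_inner_le _ _) _.
  by rewrite mulrAC ler_wpM2r ?nrm_ge0.
have [|g gS] := linear_pack S; last by exists g => u y; rewrite gS TS.
move=> a x y; apply: inner_inj => u.
by rewrite innerDr innerZr -!TS innerDr innerZr.
Qed.

End Adjoint.

(** * Isometries and their adjoints *)

Section Isometry.
Context {R : realType} {H P : hilbertSpace R}.
Context {i : {linear H -> P}} {i' : {linear P -> H}}.
Hypotheses (i_isom : isometric i) (i_adj : adjoint_pair i i').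

Lemma nrm_isom x : nrm (i x) = nrm x.
Proof. by rewrite /nrm i_isom. Qed.

(** By polarisation [i] preserves real parts of inner products, hence inner products themselves. *)
Lemma isom_coK x : i' (i x) = x.
Proof.
apply: inner_inj => u; rewrite -i_adj; move: u.
apply: eq_ReP => [a w|a w|w]; rewrite ?linearZ ?innerZl//.
have := nrmDsq (i w) (i x); rewrite -linearD !nrm_isom nrmDsq; lra.
Qed.

Lemma nrm_coisom y : nrm (i' y) <= nrm y.
Proof.
rewrite -[leRHS]mul1r; apply: (bounded_by_adjoint ler01 i_adj) => x.
by rewrite nrm_isom mul1r.
Qed.

(** Pythagoras: [|y - i (i' y)|^2 = |y|^2 - |i' y|^2]. *)
Lemma nrm_coproj y : nrm (y - i (i' y)) <= nrm y.
Proof.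
have : complex.Re (inner P (i (i' y)) y) = nrm (i' y) ^+ 2 by rewrite i_adj -nrm_sqE.
have := nrmBsq y (i (i' y)); rewrite Re_innerC nrm_isom.
have := sqr_ge0 (nrm (i' y)); have := nrm_ge0 y.
have := nrm_ge0 (y - i (i' y)); nra.
Qed.

End Isometry.

(** * Quasi-unitary estimates in the parent space *)

Section QuasiUnitary.
Context {R : realType} {H K P : hilbertSpace R}.
Context {i : {linear H -> P}} {i' : {linear P -> H}}.
Context {j : {linear K -> P}} {j' : {linear P -> K}}.
Hypotheses (i_isom : isometric i) (i_adj : adjoint_pair i i').
Hypotheses (j_isom : isometric j) (j_adj : adjoint_pair j j').

(** Stated for arbitrary maps [A] and [B], so as to cover both the resolvents and their adjoints. *)
Lemma quasi_unitary_close_of_parent (A : H -> H) (B : K -> K) d :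
  0 <= d ->
  bounded_by ((i \o A \o i') \- (j \o B \o j')) d ->
  quasi_unitary_close (j' \o i) A B d.
Proof.
set D := _ \- _ => d0 Dd.
have adjJ : adjoint (j' \o i) = i' \o j.
  by apply: adjointE => u y /=; rewrite (adjoint_pair_sym j_adj) i_adj.
have Di x : nrm (D (i x)) <= d * nrm x by rewrite -(nrm_isom i_isom) Dd.
have Dj x : nrm (D (j x)) <= d * nrm x by rewrite -(nrm_isom j_isom) Dd.
split; rewrite ?adjJ; apply: bounded_by_opnorm => // x /=.
(* Writing [A x] as [i' (i (A x))] lets the contraction [i'] factor out of the error. *)
- rewrite -{1}(isom_coK i_isom i_adj (A x)) -linearB.
  apply: le_trans (nrm_coisom i_isom i_adj _) _.
  apply: le_trans (Di x); apply: le_trans (nrm_coproj j_isom j_adj _).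
  rewrite /D/= (isom_coK i_isom i_adj) linearB linearB (isom_coK j_isom j_adj).
  by rewrite opprB addrA subrK lexx.
- rewrite -{1}(isom_coK j_isom j_adj (B x)) -linearB.
  apply: le_trans (nrm_coisom j_isom j_adj _) _.
  apply: le_trans (Dj x); apply: le_trans (nrm_coproj i_isom i_adj _).
  rewrite /D/= (isom_coK j_isom j_adj) linearB linearB (isom_coK i_isom i_adj).
  by rewrite opprB [X in _ <= nrm X]addrC addrA subrK nrmB_sym lexx.
- apply: le_trans (Di x); apply: le_trans (nrm_coisom j_isom j_adj _).
  rewrite /D/= (isom_coK i_isom i_adj) linearB (isom_coK j_isom j_adj).
  by rewrite nrmB_sym lexx.
Qed.

End QuasiUnitary.

(** * Resolvents, and the passage to QUE convergence *)

Lemma resolvent_linear {R : realType} {H : hilbertSpace R} {A : operator_in H} {z} :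
  resolvent_set A z -> exists S : {linear H -> H}, resolvent A z = S.
Proof.
move=> [[_ Ainj Asurj] _].
have rK y : dom A (resolvent A z y) /\
    A (resolvent A z y) - z *: resolvent A z y = y.
  have [x Ax <-] := Asurj y I.
  by rewrite /resolvent pinvKV ?inE// => u v /set_mem Au /set_mem Av; exact: Ainj.
have [|S SA] := linear_pack (resolvent A z); last by exists S.
(* Both sides of the linearity equation lie in [dom A] and have the same image under the injective
   map [A - z]. *)
move=> a x y; have [[[dx ex] [dy ey]] [da ea]] := (rK x, rK y, rK (a *: x + y)).
apply: Ainj; rewrite ?inE//; first exact: dom_linear.
rewrite ea op_linear// -{1}ex -{1}ey.
by rewrite scalerBr scalerDr !scalerA [z * a]mulrC opprD addrACA.
Qed.

Theorem theorem2p6 (R : realType)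
  (delta : nat -> R) (delta_ge0 : forall n, 0 <= delta n)
  (delta_cvg0 : delta n @[n --> \oo] --> 0)
  (H : nat -> hilbertSpace R) (Hinf : hilbertSpace R)
  (A : forall n, operator_in (H n)) (Ainf : operator_in Hinf)
  (A_selfadjoint : forall n, selfadjoint (A n))
  (Ainf_selfadjoint : selfadjoint Ainf)
  (z0 : R[i])
  (z0_A : forall n, resolvent_set (A n) z0) (z0_Ainf : resolvent_set Ainf z0) :
  Weidmann_converges A Ainf z0 delta -> QUE_converges A Ainf z0 delta.
Proof.
move=> [P [i [j [i_isom j_isom D_le]]]].
have adj_isom (G : hilbertSpace R) (T : {linear G -> P}) :
    isometric T -> exists T' : {linear P -> G}, adjoint_pair T T'.
  by move=> isoT; apply: (@adjoint_exists _ _ _ _ 1) => x; rewrite nrm_isom// mul1r.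
pose i' n := sval (cid (adj_isom _ _ (i_isom n))).
have i_adj n : adjoint_pair (i n) (i' n) := svalP (cid (adj_isom _ _ (i_isom n))).
have [j' j_adj] := adj_isom _ _ j_isom.
have res_adj (G : hilbertSpace R) (B : operator_in G) : resolvent_set B z0 ->
    exists S S' : {linear G -> G},
      [/\ resolvent B z0 = S, adjoint (resolvent B z0) = S' & adjoint_pair S S'].
  move=> zB; have [S BS] := resolvent_linear zB.
  have [_] := zB; rewrite BS => /opnorm_lty_bounded_by[d Sd].
  have [S' SS'] := adjoint_exists Sd.
  by exists S, S'; split => //; exact: adjointE.
have [T [T' [TE T'E TT']]] := res_adj _ _ z0_Ainf.
exists (fun n => j' \o i n); split=> [n|n].
  apply: le_lt_trans (ltry 1); apply: bounded_by_opnorm => // x /=.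
  by rewrite mul1r (le_trans (nrm_coisom j_isom j_adj _))// nrm_isom.
have [S [S' [SE S'E SS']]] := res_adj _ _ (z0_A n).
have D_bound := D_le n.
(* With linear maps in place of [resolvent] and [adjoint], the difference is itself linear, so its
   operator norm yields a pointwise bound. *)
rewrite SE TE (adjointE (i_adj n)) (adjointE j_adj) in D_bound.
have {}D_bound := opnorm_bounded_by D_bound.
split.
- apply: bounded_by_opnorm => [|x /=]; first by rewrite addr_ge0.
  apply: (le_trans (nrm_coisom j_isom j_adj _)).
  by rewrite nrm_isom// ler_peMl ?nrm_ge0// lerDl.
- by rewrite SE TE; exact: quasi_unitary_close_of_parent.
- move=> _; rewrite S'E T'E; apply: quasi_unitary_close_of_parent => //.
  (* The difference formed with [S'] and [T'] is the adjoint of the one formed with [S] and [T], so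
     it inherits the bound [delta n]. *)
  apply: bounded_by_adjoint D_bound => // u y /=.
  rewrite innerBl innerBr; congr (_ - _).
    by rewrite i_adj SS' (adjoint_pair_sym (i_adj n)).
  by rewrite j_adj TT' (adjoint_pair_sym j_adj).
Qed.
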